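(* Let $\mathcal{N}$ be a model of the base theory $F$ ($=\mathrm{RCA}_0^*$). For all $n$, the following are equivalent in $\mathcal{N}$: (a) Every finite union of finite $\Sigma^0_{n+1}$-definable sets is finite. (b) $\mathrm{B}\Sigma^0_{n+2}$.
   Context: Setting: $\mathcal{N}=(N,\mathcal{P},+,\times,<,0,1)$ with $\mathcal{P}\subseteq 2^N$ is a (possibly nonstandard) second-order model of arithmetic; elements of $N$ are called integers and elements of $\mathcal{P}$ are called sets. $\mathcal{N}$ satisfies the base theory $F$, consisting of $P^-$ (Peano arithmetic without induction), $\mathrm{I}\Delta^0_0$, the totality of exponentiation, and $\Delta^0_1$-comprehension; $F$ is also called $\mathrm{RCA}_0^*$. A formula is $\Delta^0_0$ ($=\Sigma^0_0=\Pi^0_0$) if all its quantifiers are bounded number quantifiers; $\Sigma^0_{n+1}$ formulas are a block of existential number quantifiers followed by a $\Pi^0_n$ formula, and dually for $\Pi^0_{n+1}$. Number and set parameters are allowed. Here $n\ge 0$ is a (standard) natural number indexing formula classes. A definable subset of $N$ (not necessarily in $\mathcal{P}$) is finite iff it is bounded by some integer of $N$. A finite collection of $\Sigma^0_{n+1}$-definable sets is a uniformly $\Sigma^0_{n+1}$-definable family $\{A_i\mid i<k\}$ with $k\in N$ possibly nonstandard, i.e. ''$x\in A_i$'' is given by a $\Sigma^0_{n+1}$ formula in $x$ and $i$. $\mathrm{B}\Sigma^0_m$ is the scheme asserting, for every $\Sigma^0_m$ formula $P(i,b)$ and all $r\in N$: if $\forall i<r\,\exists b_i\,P(i,b_i)$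 then $\exists b\,\forall i<r\,\exists b_i<b\,P(i,b_i)$. *)

(* Defs.v *)
(** Second-order structures [(N, P, +, *, <, 0, 1)] with [P] a family of subsets of [N]. *)
Record structure := Structure {
  carrier :> Type;
  sets : (carrier -> Prop) -> Prop;
  zero : carrier;
  one : carrier;
  add : carrier -> carrier -> carrier;
  mul : carrier -> carrier -> carrier;
  lt : carrier -> carrier -> Prop
}.

Definition set_of (N : structure) := {X : N -> Prop | sets N X}.

(** Terms and formulas of second-order arithmetic without set quantifiers.
    Number variables are de Bruijn indices; set variables are always free and
    have indices of their own. *)
Inductive term :=
| Var (i : nat)
| Zero
| One
| Add (s t : term)
| Mul (s t : term).

(** In [BAll t p] and [BEx t p], the bounded quantifiers "forall x < t" and
    "exists x < t", the quantified variable is bound in [p] only: the bound [t]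
    lives in the outer context. *)
Inductive form :=
| Eq (s t : term)
| Lt (s t : term)
| Mem (t : term) (j : nat)
| Not (p : form)
| And (p q : form)
| Or (p q : form)
| Imp (p q : form)
| BAll (t : term) (p : form)
| BEx (t : term) (p : form)
| All (p : form)
| Ex (p : form).

Fixpoint Delta00 (p : form) : Prop :=
  match p with
  | Eq _ _ | Lt _ _ | Mem _ _ => True
  | Not p => Delta00 p
  | And p q | Or p q | Imp p q => Delta00 p /\ Delta00 q
  | BAll _ p | BEx _ p => Delta00 p
  | All _ | Ex _ => False
  end.

(** Quantifier blocks may have any length, including zero. *)
Inductive Sigma : nat -> form -> Prop :=
| Sigma_Delta p : Delta00 p -> Sigma 0 p
| Sigma_Pi n p : Pi n p -> Sigma (S n) p
| Sigma_Ex n p : Sigma (S n) p -> Sigma (S n) (Ex p)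
with Pi : nat -> form -> Prop :=
| Pi_Delta p : Delta00 p -> Pi 0 p
| Pi_Sigma n p : Sigma n p -> Pi (S n) p
| Pi_All n p : Pi (S n) p -> Pi (S n) (All p).

Definition scons {T : Type} (a : T) (e : nat -> T) (i : nat) : T :=
  match i with
  | 0 => a
  | S j => e j
  end.

Fixpoint eval (N : structure) (e : nat -> N) (t : term) : N :=
  match t with
  | Var i => e i
  | Zero => zero N
  | One => one N
  | Add s t => add N (eval N e s) (eval N e t)
  | Mul s t => mul N (eval N e s) (eval N e t)
  end.

(** The valuations [e] and [V] supply the number and set parameters. *)
Fixpoint sat (N : structure) (V : nat -> set_of N) (e : nat -> N) (p : form) : Prop :=
  match p with
  | Eq s t => eval N e s = eval N e t
  | Lt s t => lt N (eval N e s) (eval N e t)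
  | Mem t j => proj1_sig (V j) (eval N e t)
  | Not p => ~ sat N V e p
  | And p q => sat N V e p /\ sat N V e q
  | Or p q => sat N V e p \/ sat N V e q
  | Imp p q => sat N V e p -> sat N V e q
  | BAll t p => forall a, lt N a (eval N e t) -> sat N V (scons a e) p
  | BEx t p => exists a, lt N a (eval N e t) /\ sat N V (scons a e) p
  | All p => forall a, sat N V (scons a e) p
  | Ex p => exists a, sat N V (scons a e) p
  end.

(** Peano arithmetic without induction: the nonnegative part of a discretely
    ordered commutative ring. *)
Record PA_minus (N : structure) : Prop := {
  PA_addA : forall x y z : N, add N (add N x y) z = add N x (add N y z);
  PA_addC : forall x y : N, add N x y = add N y x;
  PA_mulA : forall x y z : N, mul N (mul N x y) z = mul N x (mul N y z);
  PA_mulC : forall x y : N, mul N x y = mul N y x;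
  PA_mulD : forall x y z : N, mul N x (add N y z) = add N (mul N x y) (mul N x z);
  PA_add0 : forall x : N, add N x (zero N) = x;
  PA_mul0 : forall x : N, mul N x (zero N) = zero N;
  PA_mul1 : forall x : N, mul N x (one N) = x;
  PA_lt_trans : forall x y z : N, lt N x y -> lt N y z -> lt N x z;
  PA_lt_irrefl : forall x : N, ~ lt N x x;
  PA_lt_total : forall x y : N, lt N x y \/ x = y \/ lt N y x;
  PA_lt_add : forall x y z : N, lt N x y -> lt N (add N x z) (add N y z);
  PA_lt_mul : forall x y z : N,
    lt N (zero N) z -> lt N x y -> lt N (mul N x z) (mul N y z);
  PA_sub : forall x y : N, lt N x y -> exists z, add N x z = y;
  PA_lt01 : lt N (zero N) (one N);
  PA_discrete : forall x : N, lt N (zero N) x -> x = one N \/ lt N (one N) x;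
  PA_ge0 : forall x : N, x = zero N \/ lt N (zero N) x
}.

Definition IDelta00 (N : structure) : Prop :=
  forall (p : form), Delta00 p ->
  forall (V : nat -> set_of N) (e : nat -> N),
    sat N V (scons (zero N) e) p ->
    (forall x, sat N V (scons x e) p -> sat N V (scons (add N x (one N)) e) p) ->
    forall x, sat N V (scons x e) p.

(** Goedel's beta function: [v] is the remainder of [c] modulo [1 + (i + 1) * d]. *)
Definition beta (N : structure) (c d i v : N) : Prop :=
  let m := add N (one N) (mul N (add N i (one N)) d) in
  lt N v m /\ exists q, c = add N (mul N q m) v.

(** [z = x ^ y], witnessed by a beta-code of [x ^ 0, x ^ 1, ..., x ^ y].  Over
    [PA_minus] and [IDelta00], totality of this graph is equivalent to totality
    of the usual [Delta00]-definable graph of exponentiation. *)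
Definition is_exp (N : structure) (x y z : N) : Prop :=
  exists c d : N,
    beta N c d (zero N) (one N) /\
    (forall i, lt N i y ->
       exists u, beta N c d i u /\ beta N c d (add N i (one N)) (mul N u x)) /\
    beta N c d y z.

Definition exp_total (N : structure) : Prop :=
  forall x y : N, exists z, is_exp N x y z.

Definition Delta01_comprehension (N : structure) : Prop :=
  forall (p q : form), Sigma 1 p -> Pi 1 q ->
  forall (V : nat -> set_of N) (e : nat -> N),
    (forall x, sat N V (scons x e) p <-> sat N V (scons x e) q) ->
    exists X, sets N X /\ forall x, X x <-> sat N V (scons x e) p.

Record RCA0_star (N : structure) : Prop := {
  RCA_PA_minus : PA_minus N;
  RCA_IDelta00 : IDelta00 N;
  RCA_exp_total : exp_total N;
  RCA_Delta01_comprehension : Delta01_comprehension N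
}.

Definition finite (N : structure) (A : N -> Prop) : Prop :=
  exists b, forall x, A x -> lt N x b.

(** In [p], variable 0 is the element [x], variable 1 the index [i] of the family
    [A_i = {x | p(x, i)}], [i < k], and the remaining variables are parameters. *)
Definition finite_unions_finite (N : structure) (m : nat) : Prop :=
  forall (p : form), Sigma m p ->
  forall (V : nat -> set_of N) (e : nat -> N) (k : N),
    (forall i, lt N i k -> finite N (fun x => sat N V (scons x (scons i e)) p)) ->
    finite N (fun x => exists i, lt N i k /\ sat N V (scons x (scons i e)) p).

(** In [p], variable 0 is [b] and variable 1 is [i]. *)
Definition BSigma (N : structure) (m : nat) : Prop :=
  forall (p : form), Sigma m p ->
  forall (V : nat -> set_of N) (e : nat -> N) (r : N),
    (forall i, lt N i r -> exists b, sat N V (scons b (scons i e)) p) ->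
    exists b, forall i, lt N i r ->
      exists b', lt N b' b /\ sat N V (scons b' (scons i e)) p.

(* Main.v *)
Require Import Defs.
From Stdlib Require Import Classical.

(** If [P(i, b)] is [exists c, Q(c, b, i)] with [Q] in [Pi n], put
    [A_i = {x | forall b < x, forall c < x, ~ Q(c, b, i)}].  Each [A_i] is bounded
    because it excludes every [x] above a witness pair, and a bound [B] of the union
    lies in no [A_i], i.e. every [i] has a witness pair below [B].  That [A_i] is
    [Sigma n] uses closure of [Sigma n] under bounded quantification, which follows
    from [BSigma n]; hence the induction on [n].  Conversely, bounds [b_i] for
    [Sigma n] sets [A_i] satisfy the [Pi n] condition [forall y, b_i + y] not in [A_i],
    and [BSigma (S n)] bounds them uniformly. *)

(** * Substitution, and negation within the hierarchy *)

Fixpoint subst_term (f : nat -> term) (t : term) : term :=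
  match t with
  | Var i => f i
  | Zero => Zero
  | One => One
  | Add s t => Add (subst_term f s) (subst_term f t)
  | Mul s t => Mul (subst_term f s) (subst_term f t)
  end.

Definition shift : term -> term := subst_term (fun i => Var (S i)).

Definition up (f : nat -> term) : nat -> term :=
  scons (Var 0) (fun i => shift (f i)).

Fixpoint subst (f : nat -> term) (p : form) : form :=
  match p with
  | Eq s t => Eq (subst_term f s) (subst_term f t)
  | Lt s t => Lt (subst_term f s) (subst_term f t)
  | Mem t j => Mem (subst_term f t) j
  | Not p => Not (subst f p)
  | And p q => And (subst f p) (subst f q)
  | Or p q => Or (subst f p) (subst f q)
  | Imp p q => Imp (subst f p) (subst f q)
  | BAll t p => BAll (subst_term f t) (subst (up f) p)
  | BEx t p => BEx (subst_term f t) (subst (up f) p)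
  | All p => All (subst (up f) p)
  | Ex p => Ex (subst (up f) p)
  end.

(** A negation that keeps the prefix form: it flips the leading unbounded quantifiers and puts one
    [Not] on the rest, which stays [Delta00]. A plain [Not] would leave the syntactic classes. *)
Fixpoint dual (p : form) : form :=
  match p with
  | All p => Ex (dual p)
  | Ex p => All (dual p)
  | p => Not p
  end.

Scheme Sigma_mut := Minimality for Sigma Sort Prop
  with Pi_mut := Minimality for Pi Sort Prop.
Combined Scheme Sigma_Pi_ind from Sigma_mut, Pi_mut.

#[local] Hint Constructors Sigma Pi : core.

Lemma Delta00_subst p : forall f, Delta00 p -> Delta00 (subst f p).
Proof. induction p; simpl; intuition. Qed.

Lemma Sigma_Pi_subst :
  (forall n p, Sigma n p -> forall f, Sigma n (subst f p)) /\
  (forall n p, Pi n p -> forall f, Pi n (subst f p)).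
Proof.
  apply Sigma_Pi_ind; intros; simpl; auto using Delta00_subst.
Qed.

Lemma Sigma_subst n p f : Sigma n p -> Sigma n (subst f p).
Proof. intros H; apply Sigma_Pi_subst, H. Qed.

Lemma Pi_subst n p f : Pi n p -> Pi n (subst f p).
Proof. intros H; apply Sigma_Pi_subst, H. Qed.

Lemma Delta00_dual p : Delta00 p -> Delta00 (dual p).
Proof. destruct p; simpl; tauto. Qed.

Lemma Sigma_Pi_dual :
  (forall n p, Sigma n p -> Pi n (dual p)) /\
  (forall n p, Pi n p -> Sigma n (dual p)).
Proof.
  apply Sigma_Pi_ind; intros; simpl; auto using Delta00_dual.
Qed.

Lemma Sigma_dual n p : Sigma n p -> Pi n (dual p).
Proof. apply Sigma_Pi_dual. Qed.

Lemma Pi_dual n p : Pi n p -> Sigma n (dual p).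
Proof. apply Sigma_Pi_dual. Qed.

Lemma Sigma_Pi_succ :
  (forall n p, Sigma n p -> Sigma (S n) p) /\
  (forall n p, Pi n p -> Pi (S n) p).
Proof.
  apply Sigma_Pi_ind; auto.
Qed.

Lemma Sigma_succ n p : Sigma n p -> Sigma (S n) p.
Proof. apply Sigma_Pi_succ. Qed.

Lemma finite_unions_finite_pred (N : structure) n :
  finite_unions_finite N (S n) -> finite_unions_finite N n.
Proof. intros H p Hp; apply H, Sigma_succ, Hp. Qed.

(** * Semantics of substitution and negation *)

Section Semantics.

Variable N : structure.

Lemma eval_ext (e e' : nat -> N) t :
  (forall i, e i = e' i) -> eval N e t = eval N e' t.
Proof. intros He; induction t; simpl; congruence. Qed.

Lemma eval_subst (e : nat -> N) f t :
  eval N e (subst_term f t) = eval N (fun i => eval N e (f i)) t.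
Proof. induction t; simpl; congruence. Qed.

Lemma eval_shift a (e : nat -> N) t : eval N (scons a e) (shift t) = eval N e t.
Proof. apply eval_subst. Qed.

Lemma scons_ext a (e e' : nat -> N) :
  (forall i, e i = e' i) -> forall i, scons a e i = scons a e' i.
Proof. intros He [|i]; simpl; auto. Qed.

Lemma sat_ext V p : forall e e' : nat -> N,
  (forall i, e i = e' i) -> (sat N V e p <-> sat N V e' p).
Proof.
  induction p; intros e e' He; simpl;
    rewrite ?(eval_ext e e' s He), ?(eval_ext e e' t He),
      ?(IHp e e' He), ?(IHp1 e e' He), ?(IHp2 e e' He); try tauto;
    pose proof (fun a => IHp _ _ (scons_ext a e e' He)) as IH; firstorder.
Qed.

Lemma eval_up a (e : nat -> N) f i :
  eval N (scons a e) (up f i) = scons a (fun j => eval N e (f j)) i.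
Proof. destruct i; simpl; auto using eval_shift. Qed.

Lemma sat_subst V p : forall (e : nat -> N) f,
  sat N V e (subst f p) <-> sat N V (fun i => eval N e (f i)) p.
Proof.
  induction p; intros e f; simpl; rewrite ?eval_subst, ?IHp, ?IHp1, ?IHp2;
    try tauto;
    assert (IH : forall a, sat N V (scons a e) (subst (up f) p) <->
      sat N V (scons a (fun i => eval N e (f i))) p)
      by (intros a; rewrite IHp; apply sat_ext, eval_up);
    firstorder.
Qed.

Lemma sat_subst_eq V p (e e' : nat -> N) f :
  (forall i, eval N e (f i) = e' i) ->
  (sat N V e (subst f p) <-> sat N V e' p).
Proof. intros H; rewrite sat_subst; apply sat_ext, H. Qed.

Lemma sat_dual V p : forall e : nat -> N, sat N V e (dual p) <-> ~ sat N V e p.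
Proof.
  induction p; intros e; simpl; try tauto.
  - split.
    + intros [a Ha] H; apply IHp in Ha; auto.
    + intros H; apply not_all_ex_not in H as [a Ha]; exists a; apply IHp, Ha.
  - split.
    + intros H [a Ha]; apply (IHp (scons a e)); auto.
    + intros H a; apply IHp; eauto.
Qed.

(** * Closure under bounded quantification *)

Definition equiv (p q : form) : Prop :=
  forall V (e : nat -> N), sat N V e p <-> sat N V e q.

(** Closure is up to equivalence in [N], since a bounded quantifier in front of an unbounded one
    breaks the prefix form. *)
Definition closed_bounded (C : form -> Prop) : Prop :=
  forall t p, C p ->
    (exists q, C q /\ equiv q (BAll t p)) /\ (exists q, C q /\ equiv q (BEx t p)).

Lemma closed_bounded_Sigma_0 : closed_bounded (Sigma 0).
Proof.
  intros t p Hp; inversion Hp; subst.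
  split; eexists; (split; [apply Sigma_Delta | intros V e; reflexivity]); auto.
Qed.

(** Dualising exchanges the two bounded quantifiers, so each closure for [Pi n] comes from the
    opposite one for [Sigma n]. *)
Lemma closed_bounded_Pi n : closed_bounded (Sigma n) -> closed_bounded (Pi n).
Proof.
  intros H t p Hp.
  destruct (H t (dual p) (Pi_dual _ _ Hp)) as [[q [Hq Eq]] [r [Hr Er]]].
  split.
  - exists (dual r); split; [apply Sigma_dual, Hr|]; intros V e.
    rewrite sat_dual, (Er V e); simpl; split.
    + intros Hn a Ha; apply NNPP; intros Hp'; apply Hn; exists a.
      rewrite sat_dual; auto.
    + intros Ha [a [Hlt Hd]]; apply sat_dual in Hd; auto.
  - exists (dual q); split; [apply Sigma_dual, Hq|]; intros V e.
    rewrite sat_dual, (Eq V e); simpl; split.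
    + intros Hn; apply NNPP; intros Hex; apply Hn; intros a Ha.
      apply sat_dual; eauto.
    + intros [a [Hlt Hs]] Ha; apply (proj1 (sat_dual V p (scons a e))); auto.
Qed.

(** * From bounding to finite unions *)

Lemma finite_of_BSigma n :
  PA_minus N -> BSigma N (S (S n)) -> finite_unions_finite N (S n).
Proof.
  intros HP HB p Hp V e k Hfin.
  (* In the context y, b, i, this replaces the element by b + y. Ranging over b + y avoids a guard x
     >= b, so the new quantifier just extends the existential block of [p]. *)
  set (f := scons (Add (Var 1) (Var 0)) (fun i => Var (S (S i)))).
  assert (Hbd : forall b i, sat N V (scons b (scons i e)) (dual (Ex (subst f p))) <->
    forall y, ~ sat N V (scons (add N b y) (scons i e)) p).
  { intros b i; rewrite sat_dual; simpl.
    assert (Hf : forall y, sat N V (scons y (scons b (scons i e))) (subst f p) <->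
      sat N V (scons (add N b y) (scons i e)) p)
      by (intros y; apply sat_subst_eq; intros [|j]; reflexivity).
    split; [intros H y Hy; apply H; exists y; apply Hf, Hy
           | intros H [y Hy]; apply (H y), Hf, Hy]. }
  destruct (HB (dual (Ex (subst f p)))) with (V := V) (e := e) (r := k)
    as [B HB'].
  - apply Sigma_Pi, Sigma_dual, Sigma_Ex, Sigma_subst, Hp.
  - intros i Hi; destruct (Hfin i Hi) as [b Hb].
    exists b; apply Hbd; intros y Hy; apply Hb in Hy.
    destruct (PA_ge0 N HP y) as [->|Hy0].
    + rewrite (PA_add0 N HP) in Hy; exact (PA_lt_irrefl N HP _ Hy).
    + apply (PA_lt_add N HP _ _ b) in Hy0.
      rewrite (PA_addC N HP (zero N)), (PA_add0 N HP), (PA_addC N HP y) in Hy0.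
      exact (PA_lt_irrefl N HP _ (PA_lt_trans N HP _ _ _ Hy Hy0)).
  - exists B; intros x [i [Hi Hx]].
    destruct (HB' i Hi) as [b [HbB Hb]].
    rewrite Hbd in Hb.
    apply (PA_lt_trans N HP _ b); [|exact HbB].
    (* Any x >= b has the form b + y, which [Hb] excludes from the set. *)
    destruct (PA_lt_total N HP x b) as [H|[H|H]]; [exact H|exfalso|exfalso].
    + apply (Hb (zero N)); rewrite (PA_add0 N HP), <- H; exact Hx.
    + destruct (PA_sub N HP _ _ H) as [z <-]; exact (Hb z Hx).
Qed.

(** * Contraction of existential blocks and closure of [Sigma (S n)] *)

Lemma lt_succ (HP : PA_minus N) (x : N) : lt N x (add N x (one N)).
Proof.
  pose proof (PA_lt_add N HP _ _ x (PA_lt01 N HP)) as H.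
  rewrite !(PA_addC N HP _ x), (PA_add0 N HP) in H; exact H.
Qed.

Lemma common_strict_bound (HP : PA_minus N) (x y : N) :
  exists z, lt N x z /\ lt N y z.
Proof.
  destruct (PA_lt_total N HP x y) as [H|[->|H]].
  - exists (add N y (one N)); split; [|apply lt_succ; auto].
    apply (PA_lt_trans N HP _ y); auto using lt_succ.
  - exists (add N y (one N)); auto using lt_succ.
  - exists (add N x (one N)); split; [apply lt_succ; auto|].
    apply (PA_lt_trans N HP _ x); auto using lt_succ.
Qed.

(** [exists c c', q] is contracted to [exists d, exists c < d, exists c' < d, q],
    which avoids pairing functions. *)
Lemma Sigma_succ_Ex_Pi n (HP : PA_minus N) (HC : closed_bounded (Pi n)) p :
  Sigma (S n) p -> exists q, Pi n q /\ equiv p (Ex q).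
Proof.
  intros Hp; remember (S n) as m eqn:Em; induction Hp as [p Hp|m p Hp|m p Hp IH].
  - discriminate.
  - injection Em as ->.
    (* An empty block receives a vacuous quantifier. *)
    exists (subst (fun i => Var (S i)) p); split; [apply Pi_subst, Hp|].
    intros V e; simpl.
    assert (H : forall a, sat N V (scons a e) (subst (fun i => Var (S i)) p) <->
      sat N V e p) by (intros a; apply sat_subst_eq; reflexivity).
    split; [intros Hs; exists (zero N) | intros [a Hs]]; eapply H; eauto.
  - destruct (IH Em) as [q [Hq Eq]].
    (* Makes room for d behind c' and c. The bound d is [Var 1] once c is bound and [Var 0]
       outside. *)
    set (f := scons (Var 0) (scons (Var 1) (fun i => Var (S (S (S i)))))).
    destruct (HC (Var 1) (subst f q)) as [_ [q1 [Hq1 E1]]]; [apply Pi_subst, Hq|].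
    destruct (HC (Var 0) q1 Hq1) as [_ [q2 [Hq2 E2]]].
    exists q2; split; [exact Hq2|]; intros V e; simpl.
    assert (Hf : forall c' c d,
      sat N V (scons c' (scons c (scons d e))) (subst f q) <->
      sat N V (scons c' (scons c e)) q)
      by (intros; apply sat_subst_eq; intros [|[|i]]; reflexivity).
    split.
    + intros [c Hc]; apply Eq in Hc as [c' Hc'].
      destruct (common_strict_bound HP c c') as [d [Hd Hd']].
      exists d; apply E2; exists c; split; [exact Hd|].
      apply E1; exists c'; split; [exact Hd'|]; apply Hf, Hc'.
    + intros [d Hd]; apply E2 in Hd as [c [_ Hc]]; apply E1 in Hc as [c' [_ Hc']].
      exists c; apply Eq; exists c'; eapply Hf, Hc'.
Qed.

(** A bounded existential quantifier commutes with the unbounded one. For a bounded universal one,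
    [BSigma N (S n)] supplies a common bound d on the witnesses, leaving an existential quantifier
    over d before a matrix with bounded quantifiers. *)
Lemma closed_bounded_Sigma_succ n :
  PA_minus N -> closed_bounded (Sigma n) -> BSigma N (S n) ->
  closed_bounded (Sigma (S n)).
Proof.
  intros HP HS HB t p Hp.
  pose proof (closed_bounded_Pi n HS) as HC.
  destruct (Sigma_succ_Ex_Pi n HP HC p Hp) as [q [Hq Eq]].
  split.
  - set (f := scons (Var 0) (scons (Var 1) (fun i => Var (S (S (S i)))))).
    destruct (HC (Var 1) (subst f q)) as [_ [q1 [Hq1 E1]]]; [apply Pi_subst, Hq|].
    destruct (HC (shift t) q1 Hq1) as [[q2 [Hq2 E2]] _].
    exists (Ex q2); split; [apply Sigma_Ex, Sigma_Pi, Hq2|]; intros V e.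
    assert (Hf : forall c x d,
      sat N V (scons c (scons x (scons d e))) (subst f q) <->
      sat N V (scons c (scons x e)) q)
      by (intros; apply sat_subst_eq; intros [|[|i]]; reflexivity).
    split.
    + intros [d Hd] x Hx.
      apply Eq; pose proof (proj1 (E2 V _) Hd x) as H.
      rewrite eval_shift in H; apply E1 in H as [c [_ Hc]]; [|exact Hx].
      exists c; eapply Hf, Hc.
    + intros H.
      destruct (HB q (Sigma_Pi _ _ Hq) V e (eval N e t)) as [d Hd].
      { intros x Hx; apply Eq, H, Hx. }
      exists d; apply E2; intros x Hx; rewrite eval_shift in Hx.
      destruct (Hd x Hx) as [c [Hcd Hc]].
      apply E1; exists c; split; [exact Hcd|]; apply Hf, Hc.
  (* Swaps x and c, as the two quantifiers are exchanged. *)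
  - set (f := scons (Var 1) (scons (Var 0) (fun i => Var (S (S i))))).
    destruct (HC (shift t) (subst f q)) as [_ [q1 [Hq1 E1]]];
      [apply Pi_subst, Hq|].
    exists (Ex q1); split; [apply Sigma_Ex, Sigma_Pi, Hq1|]; intros V e.
    assert (Hf : forall c x,
      sat N V (scons x (scons c e)) (subst f q) <-> sat N V (scons c (scons x e)) q)
      by (intros; apply sat_subst_eq; intros [|[|i]]; reflexivity).
    split.
    + intros [c Hc]; apply E1 in Hc as [x [Hx Hc]]; rewrite eval_shift in Hx.
      exists x; split; [exact Hx|]; apply Eq; exists c; apply Hf, Hc.
    + intros [x [Hx Hs]]; apply Eq in Hs as [c Hc].
      exists c; apply E1; exists x; rewrite eval_shift; split; [exact Hx|].
      apply Hf, Hc.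
Qed.

(** * From finite unions to bounding *)

Lemma BSigma_of_finite_step n :
  PA_minus N -> closed_bounded (Sigma n) -> finite_unions_finite N n ->
  BSigma N (S n).
Proof.
  intros HP HS HF p Hp V e r Hr.
  destruct (Sigma_succ_Ex_Pi n HP (closed_bounded_Pi n HS) p Hp) as [q [Hq Eq]].
  set (f := scons (Var 0) (scons (Var 1) (fun i => Var (S (S (S i)))))).
  destruct (HS (Var 1) (subst f (dual q))) as [[q1 [Hq1 E1]] _];
    [apply Sigma_subst, Pi_dual, Hq|].
  (* [q2] defines the sets A_i; bounding both b and c by x keeps it in [Sigma n]. *)
  destruct (HS (Var 0) q1 Hq1) as [[q2 [Hq2 E2]] _].
  assert (Hsat : forall x i, sat N V (scons x (scons i e)) q2 <->
    forall b, lt N b x -> forall c, lt N c x ->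
      ~ sat N V (scons c (scons b (scons i e))) q).
  { intros x i.
    assert (Hf : forall c b,
      sat N V (scons c (scons b (scons x (scons i e)))) (subst f (dual q)) <->
      ~ sat N V (scons c (scons b (scons i e))) q).
    { intros c b; rewrite <- sat_dual; apply sat_subst_eq.
      intros [|[|j]]; reflexivity. }
    rewrite (E2 V _); split.
    - intros H b Hb c Hc; apply Hf.
      exact (proj1 (E1 V _) (H b Hb) c Hc).
    - intros H b Hb; apply E1; intros c Hc; apply Hf; exact (H b Hb c Hc). }
  destruct (HF q2 Hq2 V e r) as [B HB].
  - intros i Hi; destruct (Hr i Hi) as [b Hb]; apply Eq in Hb as [c Hc].
    destruct (common_strict_bound HP b c) as [d [Hbd Hcd]].
    exists d; intros x Hx; rewrite Hsat in Hx.
    destruct (PA_lt_total N HP x d) as [H|[->|H]]; [exact H|exfalso|exfalso].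
    + exact (Hx b Hbd c Hcd Hc).
    + exact (Hx b (PA_lt_trans N HP _ _ _ Hbd H) c (PA_lt_trans N HP _ _ _ Hcd H) Hc).
  - exists B; intros i Hi; apply NNPP; intros Hn.
    (* If i had no witness b < B, then B itself would lie in A_i, giving B < B. *)
    apply (PA_lt_irrefl N HP B), HB; exists i; split; [exact Hi|].
    apply Hsat; intros b Hb c _ Hc; apply Hn.
    exists b; split; [exact Hb|]; apply Eq; exists c; exact Hc.
Qed.

(** Closure is carried through the induction: at [S n] it needs closure and bounding from the
    previous level, and the step lemma then yields bounding at [S (S n)]. *)
Lemma BSigma_of_finite n :
  PA_minus N -> finite_unions_finite N n ->
  closed_bounded (Sigma n) /\ BSigma N (S n).
Proof.
  intros HP; induction n as [|n IH]; intros HF.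
  - split; [|apply BSigma_of_finite_step]; auto using closed_bounded_Sigma_0.
  - destruct (IH (finite_unions_finite_pred N n HF)) as [HS HB].
    pose proof (closed_bounded_Sigma_succ n HP HS HB) as HS'.
    split; [|apply BSigma_of_finite_step]; auto.
Qed.

End Semantics.

Theorem theorem8 (N : structure) (HN : RCA0_star N) (n : nat) :
  finite_unions_finite N (S n) <-> BSigma N (S (S n)).
Proof.
  pose proof (RCA_PA_minus N HN) as HP.
  split.
  - intros HF; apply (BSigma_of_finite N (S n) HP HF).
  - apply finite_of_BSigma, HP.
Qed.
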